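(* Let $\mathcal{N}$ be a network model with layers $\mathcal{L}_1,\dots,\mathcal{L}_{n+1}$, root $\mathbf{r}$ and terminal $\mathbf{t}$, and let $u$ and $v$ be two distinct nodes in $\mathcal{L}_j$ for some $j \in \{1,\dots,n\}$. (a) Suppose $\mathrm{ND}\big(\mathrm{PF}(\mathcal{N}[u,\mathbf{t}]) \cup \mathrm{PF}(\mathcal{N}[v,\mathbf{t}])\big) = \mathrm{PF}(\mathcal{N}[v,\mathbf{t}])$. If there exists a pair of labels $\ell^u \in \mathcal{Z}^{\mathrm{TD}}(u)$ and $\ell^v \in \mathcal{Z}^{\mathrm{TD}}(v)$ such that $\ell^u$ is dominated by $\ell^v$ (or $\ell^u = \ell^v$), then removing $\ell^u$ from $\mathcal{Z}^{\mathrm{TD}}(u)$ is a validity-preserving operation: if the top-down label computation is continued from layer $j$ with $\mathcal{Z}^{\mathrm{TD}}(u)$ replaced by $\mathcal{Z}^{\mathrm{TD}}(u) \setminus \{\ell^u\}$, the set of labels obtained at $\mathbf{t}$ is still $\mathrm{PF}(\mathcal{N})$. (b) Similarly, suppose $\mathrm{ND}\big(\mathrm{PF}(\mathcal{N}[\mathbf{r},u]) \cup \mathrm{PF}(\mathcal{N}[\mathbf{r},v])\big) = \mathrm{PF}(\mathcal{N}[\mathbf{r},v])$. If there exist $\ell^u \in \mathcal{Z}^{\mathrm{BU}}(u)$ and $\ell^v \in \mathcal{Z}^{\mathrm{BU}}(v)$ such that $\ell^u$ is dominated by $\ell^v$ (or $\ell^u = \ell^v$), then removing $\ell^u$ from $\mathcal{Z}^{\mathrm{BU}}(u)$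 is a validity-preserving operation: if the bottom-up label computation is continued from layer $j$ with $\mathcal{Z}^{\mathrm{BU}}(u)$ replaced by $\mathcal{Z}^{\mathrm{BU}}(u) \setminus \{\ell^u\}$, the set of labels obtained at $\mathbf{r}$ is still $\mathrm{PF}(\mathcal{N})$.
   Context: Dominance: for $y, y' \in \mathbb{R}^K$, $y$ dominates $y'$ (written $y \succ y'$) if $y_k \ge y'_k$ for all $k \in \{1,\dots,K\}$ and $y_{k} > y'_{k}$ for at least one $k$. For a set $S \subseteq \mathbb{R}^K$, $\mathrm{ND}(S) := \{ y \in S : \nexists\, y' \in S \text{ with } y' \succ y\}$. Network model: a (finite) layered acyclic multi-digraph $\mathcal{N} = (\mathcal{L}, \mathcal{A})$ (parallel arcs allowed). The node set $\mathcal{L}$ is partitioned into $n+1$ non-empty layers $\mathcal{L}_1, \dots, \mathcal{L}_{n+1}$, with $\mathcal{L}_1 = \{\mathbf{r}\}$ (root) and $\mathcal{L}_{n+1} = \{\mathbf{t}\}$ (terminal). Each arc $a$ is directed from its arc-root $r(a) \in \mathcal{L}_j$ to its arc-terminal $t(a) \in \mathcal{L}_{j+1}$ for some $j \in \{1,\dots,n\}$, and has a weight vector $w(a) \in \mathbb{R}^K$. Paths are directed and specified by their sequences of arcs; the weight $w(p)$ of a path $p$ is the sum of the weights of its arcs. The Pareto frontier of $\mathcal{N}$ is $\mathrm{PF}(\mathcal{N}) := \mathrm{ND}(\{ w(p) : p \text{ a path from } \mathbf{r} \text{ to } \mathbf{t}\})$. For nodes $x, y$ with the layer index of $x$ smaller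 than that of $y$, $\mathcal{N}[x,y]$ is the network model (with root $x$ and terminal $y$) containing only the nodes and arcs of $\mathcal{N}$ lying on some path from $x$ to $y$; hence $\mathrm{PF}(\mathcal{N}[x,y])$ is $\mathrm{ND}$ of the set of weights of paths from $x$ to $y$ (the path from a node to itself is the empty path, with weight $\mathbf{0}$). Top-down labels: $\mathcal{Z}^{\mathrm{TD}}(\mathbf{r}) := \{\mathbf{0}\}$, and, layer by layer for $i = 1, \dots, n$, for each node $x \in \mathcal{L}_{i+1}$, $\mathcal{Z}^{\mathrm{TD}}(x) := \mathrm{ND}\big(\{ z + w(a) : t(a) = x,\ z \in \mathcal{Z}^{\mathrm{TD}}(r(a)) \}\big)$. The set $\mathcal{Z}^{\mathrm{TD}}(\mathbf{t})$ produced at the end is $\mathrm{PF}(\mathcal{N})$. Bottom-up labels: $\mathcal{Z}^{\mathrm{BU}}(\mathbf{t}) := \{\mathbf{0}\}$, and, for $i = n, \dots, 1$, for each node $x \in \mathcal{L}_i$, $\mathcal{Z}^{\mathrm{BU}}(x) := \mathrm{ND}\big(\{ z + w(a) : r(a) = x,\ z \in \mathcal{Z}^{\mathrm{BU}}(t(a)) \}\big)$; the set $\mathcal{Z}^{\mathrm{BU}}(\mathbf{r})$ is $\mathrm{PF}(\mathcal{N})$. Elements of these sets are called labels. Continuing the computation from layer $j$ with a modified label set means applying the same recursion to the subsequent layers using the modified label set at $u$ and the unmodified label sets at all other nodes of $\mathcal{L}_j$. *)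

(* Defs.v *)
From HB Require Import structures.
From mathcomp Require Import all_boot all_order all_algebra.
From mathcomp Require Import boolp classical_sets reals.

Set Implicit Arguments.
Unset Strict Implicit.
Unset Printing Implicit Defensive.

Import Order.TTheory GRing.Theory Num.Theory.
Local Open Scope classical_set_scope.
Local Open Scope ring_scope.

Definition dominates (R : realType) (K : nat) (y y' : 'rV[R]_K) : Prop :=
  (forall k, y' 0 k <= y 0 k) /\ (exists k, y' 0 k < y 0 k).

Definition ND (R : realType) (K : nat) (S : set 'rV[R]_K) : set 'rV[R]_K :=
  [set y | S y /\ ~ exists y', S y' /\ dominates y' y].

(* The layers, numbered 1, ..., n.+1, are the fibres of [layer].  Arcs form a
   type of their own, with no injectivity of [a |-> (arc_root a, arc_term a)],
   so parallel arcs are allowed. *)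
Record network (R : realType) (K n : nat) := Network {
  node : finType;
  arc : finType;
  layer : node -> nat;
  arc_root : arc -> node;
  arc_term : arc -> node;
  weight : arc -> 'rV[R]_K;
  net_root : node;
  net_terminal : node;
  layer_range : forall x, (1 <= layer x <= n.+1)%N;
  layer_nonempty : forall i, (1 <= i <= n.+1)%N -> exists x, layer x = i;
  layer_root : forall x, layer x = 1%N <-> x = net_root;
  layer_terminal : forall x, layer x = n.+1 <-> x = net_terminal;
  layer_arc : forall a, layer (arc_term a) = (layer (arc_root a)).+1
}.

Arguments layer {R K n N} x : rename.
Arguments arc_root {R K n N} a : rename.
Arguments arc_term {R K n N} a : rename.
Arguments weight {R K n N} a : rename.

Section Labels.
Variables (R : realType) (K n : nat) (N : network R K n).
Implicit Types (x y : node N) (a : arc N) (p : seq (arc N)).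

Fixpoint is_path x p y : bool :=
  if p is a :: p' then (arc_root a == x) && is_path (arc_term a) p' y
  else x == y.

Definition path_weight p : 'rV[R]_K := \sum_(a <- p) weight a.

(* The Pareto frontier of N[x, y].  N[x, y] keeps exactly the nodes and arcs
   lying on some path of N from x to y, so its root-terminal paths are the
   paths of N from x to y.  It is set0 when there is no such path. *)
Definition PF_between x y : set 'rV[R]_K :=
  ND [set path_weight p | p in [set p | is_path x p y]].

Definition PF : set 'rV[R]_K := PF_between (net_root N) (net_terminal N).

Definition labeling := node N -> set 'rV[R]_K.

(* Iteration i of the top-down computation: it overwrites the label sets of
   the nodes of layer i.+1 and leaves all others unchanged. *)
Definition td_step (Z : labeling) (i : nat) : labeling := fun x =>
  if layer x == i.+1 then
    ND [set l | exists a z,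
          [/\ arc_term a = x, Z (arc_root a) z & l = z + weight a]]
  else Z x.

(* Iterations i = j, j+1, ..., n, in this order: layers j+1, ..., n+1 are
   recomputed from the label sets given by Z at layer j. *)
Definition td_run (j : nat) (Z : labeling) : labeling :=
  foldl td_step Z (index_iota j n.+1).

Definition ZTD : labeling :=
  td_run 1 (fun x => if x == net_root N then [set 0] else set0).

(* Iteration i of the bottom-up computation: it overwrites layer i. *)
Definition bu_step (i : nat) (Z : labeling) : labeling := fun x =>
  if layer x == i then
    ND [set l | exists a z,
          [/\ arc_root a = x, Z (arc_term a) z & l = z + weight a]]
  else Z x.

(* Iterations i = j-1, j-2, ..., 1, in this order (foldr handles the last index
   first): layers j-1, ..., 1 are recomputed from the label sets given by Z at
   layer j. *)
Definition bu_run (j : nat) (Z : labeling) : labeling :=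
  foldr bu_step Z (index_iota 1 j).

Definition ZBU : labeling :=
  bu_run n.+1 (fun x => if x == net_terminal N then [set 0] else set0).

Definition remove_label (Z : labeling) (u : node N) (l : 'rV[R]_K) : labeling :=
  fun x => if x == u then Z u `\ l else Z x.

End Labels.

Arguments PF {R K n} N.
Arguments ZTD {R K n N} x.
Arguments ZBU {R K n N} x.

(* Main.v *)
Require Import Defs.
From mathcomp Require Import all_boot all_order all_algebra.
From mathcomp Require Import boolp classical_sets reals.
From mathcomp Require Import cardinality zify.

(** Running the top-down recursion from layer [j] with finite label sets [Z]
    yields at the terminal the nondominated part of the set of all [z + w(p)]
    with [z] in [Z x], [x] in layer [j] and [p] a path from [x] to the terminal:
    each step only discards labels that are weakly dominated by a kept one, and
    adding the weight of a common path preserves weak dominance.  Removing [lu]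
    only loses the values [lu + w(p)] with [p] starting at [u]; by the
    hypothesis [w(p)] is weakly dominated by some [w(q)] with [q] starting at
    [v], so [lv + w(q)] makes up for the loss.  Part (b) is part (a) for the
    network with all arcs reversed. *)

Set Implicit Arguments.
Unset Strict Implicit.

Import Order.TTheory GRing.Theory Num.Theory.
Local Open Scope classical_set_scope.
Local Open Scope ring_scope.

(** * Weak dominance and nondominated parts of finite sets *)

Definition weakly_dominates {R : realType} {K : nat} (y y' : 'rV[R]_K) : Prop :=
  forall k, y' 0 k <= y 0 k.

Definition covers {R : realType} {K : nat} (B A : set 'rV[R]_K) : Prop :=
  forall a, A a -> exists2 b, B b & weakly_dominates b a.

Section Dominance.
Context {R : realType} {K : nat}.
Implicit Types (x y z : 'rV[R]_K) (A B : set 'rV[R]_K).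

Lemma weakly_dominates_refl y : weakly_dominates y y.
Proof. by []. Qed.

Lemma weakly_dominates_trans y x z :
  weakly_dominates x y -> weakly_dominates y z -> weakly_dominates x z.
Proof. by move=> xy yz k; apply: le_trans (yz k) (xy k). Qed.

Lemma weakly_dominatesD x y x' y' :
  weakly_dominates x y -> weakly_dominates x' y' ->
  weakly_dominates (x + x') (y + y').
Proof. by move=> xy xy' k; rewrite !mxE lerD. Qed.

Lemma weakly_dominatesE x y : weakly_dominates x y <-> dominates x y \/ y = x.
Proof.
split=> [xy|[[]//|->]]; last exact: weakly_dominates_refl.
have [[k ltk]|nlt] := pselect (exists k, y 0 k < x 0 k).
  by left; split=> //; exists k.
right; apply/rowP => k; apply/eqP; rewrite eq_le xy leNgt.
by apply/negP => ltk; apply: nlt; exists k.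
Qed.

Lemma weakly_dominates_dominates y x z :
  weakly_dominates x y -> dominates y z -> dominates x z.
Proof.
move=> xy [yz [k ltk]]; split; first exact: weakly_dominates_trans xy yz.
by exists k; apply: lt_le_trans ltk (xy k).
Qed.

Lemma sub_ND A : ND A `<=` A.
Proof. by move=> y []. Qed.

Lemma NDK A : ND (ND A) = ND A.
Proof.
apply/seteqP; split=> [y []//|y NDy]; split=> // -[x [Ax xy]].
by case: NDy => _; apply; exists x; split=> //; apply: sub_ND.
Qed.

(** Climb from a point to one dominating it until none does. The climb stops because the list
    enclosing the points of [A] weakly above the current one shrinks at each move. *)
Lemma ND_covers A : finite_set A -> covers (ND A) A.
Proof.
move=> /finite_seqP[s As] y Ay.
have: forall x, A x -> weakly_dominates x y -> x \in s by rewrite As.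
clear As; move: {2}(size s) (leqnn (size s)) => m.
elim: m s y Ay => [|m IHm] s y Ay size_s sub_s.
  move: size_s sub_s; rewrite leqn0 size_eq0 => /eqP-> sub_nil.
  by have := sub_nil y Ay (weakly_dominates_refl y).
have [NDy|nNDy] := pselect (ND A y); first by exists y.
have [x [Ax xy]] : exists x, A x /\ dominates x y.
  by apply: contrapT => nx; apply: nNDy.
have ys : y \in s by apply: sub_s.
(* The point [y] does not weakly dominate [x], so it can be struck from the list. *)
have [||b NDb bx] := IHm (filter (predC1 y) s) x Ax.
- rewrite size_filter -ltnS (leq_trans _ size_s)// -(count_predC (pred1 y) s).
  by rewrite -[X in (X < _)%N]add0n ltn_add2r -has_count has_pred1.
- move=> z Az zx; rewrite mem_filter /=; apply/andP; split.
    apply/eqP => zy; have [_ [k]] := xy.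
    by rewrite ltNge -zy zx.
  by apply: sub_s => //; apply: weakly_dominates_trans zx _; case: xy.
by exists b => //; apply: weakly_dominates_trans bx _; case: xy.
Qed.

(** A nondominated point of [A] is weakly dominated by a point of [B], which can only be that point
    itself. Conversely, if a point of [A] dominates [y], so does the point of [B] covering it. *)
Lemma eq_ND_covers A B : B `<=` A -> covers B A -> ND B = ND A.
Proof.
move=> BA cBA; apply/seteqP; split=> y [Sy maxy].
  split=> [|[x [Ax xy]]]; first exact: BA.
  have [b Bb bx] := cBA _ Ax.
  by apply: maxy; exists b; split=> //; apply: weakly_dominates_dominates bx xy.
have [b Bb /weakly_dominatesE[bx|yb]] := cBA _ Sy.
  by case: maxy; exists b; split=> //; apply: BA.
by split=> [|[x [Bx xy]]]; [rewrite yb|apply: maxy; exists x; split=> //; apply: BA].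
Qed.

End Dominance.

(** * The top-down recursion and its invariant *)

Section TopDown.
Context {R : realType} {K n : nat} {N : network R K n}.
Implicit Types (x y : node N) (Z : labeling N) (p : seq (Defs.arc N)).
Local Notation t := (net_terminal N).

Lemma path_weight_cons (a : Defs.arc N) p :
  path_weight (a :: p) = weight a + path_weight p.
Proof. by rewrite /path_weight big_cons. Qed.

Lemma layer_path x p y : is_path x p y -> layer y = (layer x + size p)%N.
Proof.
elim: p x => [|a p IHp] x /=; first by move/eqP->; rewrite addn0.
by case/andP => /eqP<- /IHp ->; rewrite layer_arc addSnnS.
Qed.

(** Layering fixes the length of all paths from [x] to [y], so they are tuples over a finite
    type. *)
Lemma finite_path_weights x y :
  finite_set [set path_weight p | p in [set p | is_path x p y]].
Proof.
pose f (p : (layer y - layer x).-tuple (Defs.arc N)) := path_weight p.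
apply: (@sub_finite_set _ _ (range f)); last exact: finite_image.
move=> _ [p /= xpy <-]; have sp : size p == (layer y - layer x)%N.
  by rewrite (layer_path xpy) addKn.
by exists (Tuple sp).
Qed.

(** The nondominated part of this set is the invariant of the recursion. *)
Definition completions Z (j : nat) : set 'rV[R]_K :=
  [set l | exists x z p,
     [/\ layer x = j, Z x z, is_path x p t & l = z + path_weight p]].

Lemma finite_candidates Z x : (forall x, finite_set (Z x)) ->
  finite_set [set l | exists a z,
    [/\ arc_term a = x, Z (arc_root a) z & l = z + weight a]].
Proof.
move=> finZ; apply: (@sub_finite_set _ _
  (\bigcup_(a in [set: Defs.arc N]) ((fun z => z + weight a) @` Z (arc_root a)))).
  by move=> l [a [z [_ Zz ->]]]; exists a => //; exists z.
by apply: bigcup_finite => // a _; apply: finite_image.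
Qed.

Lemma finite_td_step Z i : (forall x, finite_set (Z x)) ->
  forall x, finite_set (td_step Z i x).
Proof.
move=> finZ x; rewrite /td_step; case: ifP => // _.
by apply: sub_finite_set (@sub_ND _ _ _) _; apply: finite_candidates.
Qed.

Lemma finite_foldl_td_step s Z : (forall x, finite_set (Z x)) ->
  forall x, finite_set (foldl (@td_step R K n N) Z s x).
Proof. by elim: s Z => //= i s IHs Z finZ; apply/IHs/finite_td_step. Qed.

Lemma foldl_td_step_id s Z x : (forall i, i \in s -> (layer x <= i)%N) ->
  foldl (@td_step R K n N) Z s x = Z x.
Proof.
elim: s Z => //= i s IHs Z ge_s; rewrite IHs; last first.
  by move=> k ks; apply: ge_s; rewrite in_cons ks orbT.
by rewrite /td_step ltn_eqF// ltnS ge_s// mem_head.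
Qed.

(** A new completion is an old one whose first arc has been absorbed into the label. Conversely,
    absorbing the first arc gives a candidate label; a kept label weakly dominates it and takes over
    the rest of the path. *)
Lemma ND_completions_td_step Z j : (j <= n)%N -> (forall x, finite_set (Z x)) ->
  ND (completions (td_step Z j) j.+1) = ND (completions Z j).
Proof.
move=> jn finZ; apply: eq_ND_covers.
  move=> _ [x [z [p [xj + xpt ->]]]]; rewrite /td_step xj eqxx.
  case/sub_ND => a [z' [ax Zz' ->]].
  exists (arc_root a), z', (a :: p); split=> //=.
  - by have := layer_arc a; rewrite ax xj => -[].
  - by rewrite eqxx ax.
  - by rewrite path_weight_cons addrA.
move=> _ [x [z [[|a p] [xj Zz /= xpt ->]]]].
  (* An empty path would put the terminal in layer [j], against [j <= n]. *)
  have /eqP := xj; rewrite (eqP xpt) (layer_terminal t).2// => /eqP jE.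
  by move: jn; rewrite -jE ltnn.
case/andP: xpt => /eqP ax apt; pose y := arc_term a.
have yj : layer y = j.+1 by rewrite layer_arc ax xj.
have [|b NDb bz] := @ND_covers _ _ _ (finite_candidates y finZ) (z + weight a).
  by exists a, z; rewrite ax.
exists (b + path_weight p).
  by exists y, b, p; split=> //; rewrite /td_step yj eqxx.
rewrite path_weight_cons addrA.
by apply: weakly_dominatesD bz _; apply: weakly_dominates_refl.
Qed.

Lemma ND_completions_foldl Z j m : (j + m <= n.+1)%N ->
  (forall x, finite_set (Z x)) ->
  ND (completions (foldl (@td_step R K n N) Z (iota j m)) (j + m)) =
  ND (completions Z j).
Proof.
elim: m j Z => [|m IHm] j Z jm finZ; first by rewrite addn0.
rewrite /= -addSnnS IHm ?addSnnS//; last exact: finite_td_step.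
by apply: ND_completions_td_step => //; lia.
Qed.

Lemma completions_terminal Z : completions Z n.+1 = Z t.
Proof.
apply/seteqP; split=> [_ [x [z [p [xn Zz xpt ->]]]]|z Zz].
  have xt : x = t by apply/layer_terminal.
  have := layer_path xpt; rewrite xt => /eqP.
  rewrite -[X in X == _]addn0 eqn_add2l eq_sym size_eq0 => /eqP ->.
  by rewrite /path_weight big_nil addr0 -xt.
exists t, z, [::]; split=> //=; first exact/layer_terminal.
by rewrite /path_weight big_nil addr0.
Qed.

Lemma td_run_terminal Z j : (j <= n)%N -> (forall x, finite_set (Z x)) ->
  td_run j Z t = ND (completions Z j).
Proof.
move=> jn finZ; have <- := @ND_completions_foldl Z j (n.+1 - j) _ finZ; last by lia.
rewrite -/(index_iota j n.+1) subnKC ?leqW// completions_terminal.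
(* Iteration [n] is split off: it already takes the nondominated part at the terminal. *)
rewrite -/(td_run j Z) /td_run /index_iota subSn// -(addn1 (n - j)) iotaD foldl_cat /=.
by rewrite subnKC// /td_step (layer_terminal t).2// eqxx NDK.
Qed.

Lemma eq_completions Z Z' j :
  (forall x, layer x = j -> Z x = Z' x) -> completions Z j = completions Z' j.
Proof.
by move=> ZZ'; apply/seteqP; split=> _ [x [z [p [xj Zz xpt ->]]]];
  exists x, z, p; split=> //; move: Zz; rewrite (ZZ' x xj).
Qed.

Local Notation Z0 := (fun x => if x == net_root N then [set 0] else set0).

Lemma finite_init x : finite_set (Z0 x : set 'rV[R]_K).
Proof. by move=> /=; case: (x == _); [apply: finite_set1|apply: finite_set0]. Qed.

Lemma finite_ZTD x : finite_set (ZTD x).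
Proof. by apply: finite_foldl_td_step; apply: finite_init. Qed.

(** Layer [j] is final after iterations 1 to [j.-1], and the invariant leads from there back to
    layer 1. *)
Lemma PF_completions j : (1 <= j <= n)%N -> PF N = ND (completions ZTD j).
Proof.
move=> /andP[j0 jn].
have -> : completions ZTD j =
    completions (foldl (@td_step R K n N) Z0 (iota 1 j.-1)) j.
  apply: eq_completions => x xj; rewrite /ZTD /td_run.
  have -> : index_iota 1 n.+1 = iota 1 (j.-1 + (n - j.-1)).
    by rewrite /index_iota; congr iota; lia.
  rewrite iotaD foldl_cat foldl_td_step_id// => i.
  by rewrite mem_iota xj add1n prednK// => /andP[].
have := @ND_completions_foldl Z0 1 j.-1; rewrite add1n prednK// => ->; last 2 first.
- by lia.
- exact: finite_init.
(* The only label in layer 1 is 0 at the root, so its completions are the weights of root-terminal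
   paths. *)
congr ND; apply/seteqP; split=> [_ [p rpt <-]|_ [x [z [p [x1 + xpt ->]]]]].
  exists (net_root N), 0, p; split=> //; first exact/layer_root.
    by rewrite eqxx.
  by rewrite add0r.
have xr : x = net_root N by apply/layer_root.
rewrite xr eqxx => ->; exists p; last by rewrite add0r.
by rewrite /= -xr.
Qed.

Lemma td_remove_label j u v lu lv : (1 <= j <= n)%N -> u <> v ->
  layer v = j ->
  ND (PF_between u t `|` PF_between v t) = PF_between v t ->
  ZTD v lv -> weakly_dominates lv lu ->
  td_run j (remove_label ZTD u lu) t = PF N.
Proof.
move=> hj uv vj PFuv Zv lvu; have /andP[_ jn] := hj.
have finPF x : finite_set (PF_between x t).
  exact: sub_finite_set (@sub_ND _ _ _) (finite_path_weights x t).
have remS x : remove_label ZTD u lu x `<=` ZTD x.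
  by rewrite /remove_label; case: eqP => [->|_] // l [].
rewrite (PF_completions hj) td_run_terminal//; last first.
  by move=> x; apply: sub_finite_set (remS x) (finite_ZTD x).
apply: eq_ND_covers => [_ [x [z [p [xj Zz xpt ->]]]]|].
  by exists x, z, p; split=> //; apply: remS.
move=> _ [x [z [p [xj Zz xpt ->]]]].
(* Only completions of [lu] at [u] can be lost. *)
have [[xu zlu]|nrem] := pselect (x = u /\ z = lu); last first.
  exists (z + path_weight p); last exact: weakly_dominates_refl.
  exists x, z, p; split=> //; rewrite /remove_label; case: eqP => // xu.
  by split; [rewrite -xu|move=> zl; apply: nrem].
(* Two coverings replace [p] by a path [q] from [v]: first by the frontier at [u], then by the
   nondominated part of the union, which is the frontier at [v]. *)
have [|b PFb bp] := @ND_covers _ _ _ (finite_path_weights u t) (path_weight p).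
  by exists p => //=; rewrite -xu.
have finU : finite_set (PF_between u t `|` PF_between v t) by rewrite finite_setU.
have [c] := ND_covers finU (or_introl PFb).
rewrite PFuv => /sub_ND[q vqt <-] qb.
(* As [u] and [v] differ, [lv] survives the removal. *)
exists (lv + path_weight q).
  exists v, lv, q; split=> //; rewrite /remove_label.
  by case: eqP => // vu; case: uv.
rewrite zlu; apply: weakly_dominatesD lvu _.
exact: weakly_dominates_trans qb bp.
Qed.

End TopDown.

(** * Reversal of the arcs, turning bottom-up into top-down *)

Section Reversal.
Context {R : realType} {K n : nat}.
Variable N : network R K n.

(** Left transparent: nodes and arcs must be convertible with those of [N], so that one labeling
    serves both networks. *)
Definition rev_network : network R K n.
Proof.
refine (@Network R K n (node N) (Defs.arc N) (fun x => n.+2 - layer x)%N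
  arc_term arc_root weight (net_terminal N) (net_root N) _ _ _ _ _).
- by move=> x; have := layer_range x; lia.
- move=> i i_n; have [|x xi] := @layer_nonempty _ _ _ N (n.+2 - i)%N; first by lia.
  by exists x; lia.
- move=> x; rewrite -layer_terminal; have := layer_range x; lia.
- move=> x; rewrite -layer_root; have := layer_range x; lia.
- move=> a; have := layer_range (arc_term a); rewrite layer_arc; lia.
Defined.

Lemma is_path_cat {M : network R K n} (x : node M) p q y :
  is_path x (p ++ q) y <-> exists2 z, is_path x p z & is_path z q y.
Proof.
elim: p x => [|a p IHp] x /=.
  by split=> [xqy|[z /eqP->]//]; exists x.
split=> [/andP[-> /IHp[z]]|[z /andP[-> apz zqy]]]; first by exists z.
by apply/IHp; exists z.
Qed.

Lemma is_path_rev (x y : node N) p :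
  is_path x p y <-> @is_path _ _ _ rev_network y (rev p) x.
Proof.
elim: p x => [|a p IHp] x /=; first by rewrite eq_sym.
rewrite rev_cons -cats1 is_path_cat; split.
  case/andP => /eqP ax /IHp ap; exists (arc_term a : node rev_network) => //=.
  by rewrite eqxx; apply/eqP.
by case=> z /= yz /andP[/eqP az /eqP ax]; rewrite ax eqxx; apply/IHp; rewrite az.
Qed.

Lemma PF_between_rev (x y : node N) :
  @PF_between _ _ _ rev_network y x = PF_between x y.
Proof.
have sum_rev p : @path_weight _ _ _ rev_network (rev p) = @path_weight _ _ _ N p.
  by rewrite /path_weight (perm_big p)// perm_rev.
congr ND; apply/seteqP; split=> _ [p pxy <-]; exists (rev p).
- by apply/is_path_rev; rewrite revK.
- by rewrite -sum_rev revK.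
- exact/is_path_rev.
- exact: sum_rev.
Qed.

(** Layer [i] of [N] is layer [n.+2 - i] of the reversed network, which iteration [n.+1 - i]
    writes. *)
Lemma bu_step_rev (Z : labeling N) i : (1 <= i <= n)%N ->
  bu_step i Z = @td_step _ _ _ rev_network Z (n.+1 - i)%N.
Proof.
move=> i_n; apply/funext => x; rewrite /bu_step /td_step /=.
suff -> : (n.+2 - layer x == (n.+1 - i).+1)%N = (layer x == i) by [].
by have := layer_range x; lia.
Qed.

Lemma bu_run_rev (Z : labeling N) j : (1 <= j <= n.+1)%N ->
  bu_run j Z = @td_run _ _ _ rev_network (n.+2 - j)%N Z.
Proof.
rewrite /bu_run /td_run /index_iota => j_n.
have -> : (n.+1 - (n.+2 - j) = j - 1)%N by lia.
have -> : (n.+2 - j = n.+1 - (j - 1))%N by lia.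
have : (j - 1 <= n)%N by lia.
elim: (j - 1)%N Z => // m IHm Z m_n.
(* [foldr] handles the last index first, so that index is split off; it becomes the first iteration
   of the reversed run. *)
rewrite -[in LHS](addn1 m) iotaD foldr_cat /= bu_step_rev; last by lia.
rewrite IHm; last by lia.
have -> : (n.+1 - (1 + m) = n.+1 - m.+1)%N by lia.
by have -> : (n.+1 - m = (n.+1 - m.+1).+1)%N by lia.
Qed.

Lemma ZBU_rev : @ZBU _ _ _ N = @ZTD _ _ _ rev_network.
Proof. by rewrite /ZBU bu_run_rev ?leqnn// subSnn. Qed.

End Reversal.

Theorem proposition3 (R : realType) (K n : nat) (N : network R K n) (j : nat)
    (hj : (1 <= j <= n)%N) (u v : node N) (huv : u <> v)
    (hu : layer u = j) (hv : layer v = j) :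
  (ND (PF_between u (net_terminal N) `|` PF_between v (net_terminal N))
     = PF_between v (net_terminal N) ->
   forall lu lv : 'rV[R]_K, ZTD u lu -> ZTD v lv ->
     dominates lv lu \/ lu = lv ->
     td_run j (remove_label ZTD u lu) (net_terminal N) = PF N)
  /\
  (ND (PF_between (net_root N) u `|` PF_between (net_root N) v)
     = PF_between (net_root N) v ->
   forall lu lv : 'rV[R]_K, ZBU u lu -> ZBU v lv ->
     dominates lv lu \/ lu = lv ->
     bu_run j (remove_label ZBU u lu) (net_root N) = PF N).
Proof.
split=> PFuv lu lv _ Zv /weakly_dominatesE lvu.
  exact: td_remove_label PFuv Zv lvu.
(* Layer 1 is a singleton, so [u <> v] forces [1 < j]; the reversed index
   [n.+2 - j] is then again in [1, n]. *)
have j1 : (1 < j)%N.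
  rewrite ltnNge; apply/negP => j_le1; apply: huv.
  by transitivity (net_root N); [|symmetry]; apply/layer_root; lia.
rewrite bu_run_rev; last by lia.
rewrite ZBU_rev in Zv *; rewrite /PF -PF_between_rev.
apply: (@td_remove_label _ _ _ (rev_network N) _ u v lu lv) => //=; try lia.
by rewrite !PF_between_rev.
Qed.
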